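(* Let $G$ be a disconnected graph of order $n$. Then $SEC(G)=n$ if and only if $G\cong K_p\cup K_q$ for some positive integers $p,q$ with $p+q=n$, where $K_p\cup K_q$ denotes the disjoint union of the complete graphs $K_p$ and $K_q$.
   Context: Graphs are finite and simple with a non-empty vertex set; $n=|V(G)|$ is the order of $G$. A set $D\subseteq V(G)$ is a dominating set if every vertex of $V(G)\setminus D$ is adjacent to at least one vertex of $D$. A secure dominating set $S$ of $G$ is a dominating set such that each vertex $u\in V(G)\setminus S$ is adjacent to some vertex $v\in S$ for which $(S\setminus\{v\})\cup\{u\}$ is a dominating set. Two disjoint vertex sets $V_1,V_2\subseteq V(G)$ form a secure coalition if neither $V_1$ nor $V_2$ is a secure dominating set but $V_1\cup V_2$ is a secure dominating set. A secure coalition partition ($sec$-partition) of $G$ is a partition $\pi=\{V_1,\dots,V_k\}$ of $V(G)$ (into non-empty sets) such that every $V_i$ either is a secure dominating set consisting of a single vertex of degree $n-1$, or is not a secure dominating set but forms a secure coalition with another set $V_j\in\pi$. The secure coalition number $SEC(G)$ is the maximum cardinality of a secure coalition partition of $G$ (every graph has at least one such partition). *)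

(* Defs.v *)
From mathcomp Require Import all_boot.
Set Implicit Arguments.
Unset Strict Implicit.
Unset Printing Implicit Defensive.

Record graph := Graph {
  vertex :> finType;
  adj : rel vertex;
  adj_sym : symmetric adj;
  adj_irrefl : irreflexive adj
}.

Definition connected (G : graph) : bool :=
  [forall x : G, forall y : G, connect (@adj G) x y].

Definition isomorphic (G H : graph) : Prop :=
  exists f : G -> H, bijective f /\ (forall x y : G, adj (f x) (f y) = adj x y).

Definition complete_adj (n : nat) : rel 'I_n := fun x y => x != y.

Lemma complete_adj_sym (n : nat) : symmetric (@complete_adj n).
Proof. by move=> x y; rewrite /complete_adj eq_sym. Qed.

Lemma complete_adj_irrefl (n : nat) : irreflexive (@complete_adj n).
Proof. by move=> x; rewrite /complete_adj eqxx. Qed.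

Definition complete_graph (n : nat) : graph :=
  Graph (@complete_adj_sym n) (@complete_adj_irrefl n).

Definition union_adj (G H : graph) : rel (G + H)%type := fun x y =>
  match x, y with
  | inl a, inl b => adj a b
  | inr a, inr b => adj a b
  | _, _ => false
  end.

Lemma union_adj_sym (G H : graph) : symmetric (@union_adj G H).
Proof. by case=> a [] b //=; apply: adj_sym. Qed.

Lemma union_adj_irrefl (G H : graph) : irreflexive (@union_adj G H).
Proof. by case=> a /=; apply: adj_irrefl. Qed.

Definition disjoint_union (G H : graph) : graph :=
  Graph (@union_adj_sym G H) (@union_adj_irrefl G H).

Section SecureCoalition.

Variable G : graph.
Implicit Types (S V W : {set G}) (P : {set {set G}}).

Definition degree (v : G) : nat := #|[set u | adj v u]|.

Definition dominating S : bool :=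
  [forall (u | u \notin S), exists v in S, adj u v].

Definition secure_dominating S : bool :=
  dominating S &&
  [forall (u | u \notin S),
    exists v in S, adj u v && dominating (u |: (S :\ v))].

Definition secure_coalition V W : bool :=
  [&& [disjoint V & W], ~~ secure_dominating V, ~~ secure_dominating W
    & secure_dominating (V :|: W)].

(* [partition] already requires the blocks to be non-empty. *)
Definition sec_partition P : bool :=
  partition P [set: G] &&
  [forall V in P,
    (secure_dominating V && [exists v, (V == [set v]) && (degree v == #|G|.-1)])
    || (~~ secure_dominating V && [exists W in P, (W != V) && secure_coalition V W])].

(* The value would be 0 in the absence of any secure coalition partition. *)
Definition SEC : nat := \max_(P : {set {set G}} | sec_partition P) #|P|.

End SecureCoalition.

(* Main.v *)
Require Import Defs.
From mathcomp Require Import all_boot.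

Set Implicit Arguments.
Unset Strict Implicit.
Unset Printing Implicit Defensive.

(** A partition of the vertex set into [#|G|] blocks is the partition into
    singletons, so the theorem asks when every singleton either is a universal
    vertex, which is impossible in a disconnected graph, or has a partner.

    Suppose that [v] and [w] form a secure dominating pair of a disconnected
    graph.  They lie in different components, for otherwise everything that
    they dominate would be connected; hence the graph has exactly two
    components, one around each of them, and every vertex in the component
    of [v] is dominated by [v].  Security allows only [v] to move to another
    vertex [x] of its component, and [x] then has to dominate that component by
    itself.  So each component is a clique
    ([secure_dominating_pair_clique]), and one partnered singleton is enough to
    determine the graph.

    Conversely, in a disjoint union of two cliques a set that meets both sides
    is dominating, and replacing a vertex by a neighbour preserves the side.
    So each pair of vertices from different sides is secure dominating, while
    no singleton dominates the opposite side.

    Both directions describe the graph by a predicate [a] telling the two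
    cliques apart ([two_cliques]); [isomorphic_two_cliquesP] translates this
    into an isomorphism with the union of two complete graphs. *)

(** * Partitions with as many blocks as elements *)

(** The size of the partitioned set is a sum of block sizes, each at least 1. *)
Lemma card_partition_leqif (T : finType) (P : {set {set T}}) (D : {set T}) :
  partition P D -> #|P| <= #|D| ?= iff [forall A in P, #|A| == 1].
Proof.
move=> partP; rewrite (card_partition partP) -sum1_card.
have /leqif_sum le1 : forall A : {set T}, A \in P -> 1 <= #|A| ?= iff (#|A| == 1).
  move=> A PA; split; last by rewrite eq_sym.
  rewrite card_gt0; apply: contraTneq PA => ->.
  by case/and3P: partP.
exact: le1.
Qed.

Definition singletons (T : finType) : {set {set T}} := [set [set x] | x : T].

Lemma card_singletons (T : finType) : #|singletons T| = #|T|.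
Proof. by rewrite card_imset //; apply: set1_inj. Qed.

Lemma singletons_partition (T : finType) : partition (singletons T) [set: T].
Proof.
apply/and3P; split.
- apply/eqP/setP=> x; rewrite in_setT; apply/bigcupP.
  by exists [set x]; rewrite ?set11 ?imset_f.
- apply/trivIsetP=> _ _ /imsetP[x _ ->] /imsetP[y _ ->] neq_xy.
  by rewrite disjoints1 inE; apply: contraNneq neq_xy => ->.
- apply/imsetP=> -[x _] /setP/(_ x).
  by rewrite !inE eqxx.
Qed.

Lemma SEC_leq (G : graph) : SEC G <= #|G|.
Proof.
apply/bigmax_leqP=> P /andP[partP _].
by rewrite -cardsT (card_partition_leqif partP).
Qed.

(** Positivity excludes the default value of an empty maximum. *)
Lemma SEC_attained (G : graph) :
  0 < SEC G -> exists2 P, @sec_partition G P & #|P| = SEC G.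
Proof.
move=> SEC_gt0;
case: (pickP (@sec_partition G)) => [P0 secP0 | noP].
  have := @eq_bigmax_cond _ (@sec_partition G) (fun P : {set {set G}} => #|P|).
  by case=> [|P secP eqP]; [apply/card_gt0P; exists P0 | exists P].
by move: SEC_gt0; rewrite /SEC big_pred0.
Qed.

(** * Secure dominating pairs in a disconnected graph *)

Lemma dominatingP (G : graph) (S : {set G}) :
  reflect (forall u, u \notin S -> exists2 v, v \in S & adj u v) (dominating S).
Proof.
apply: (iffP forall_inP) => domS u uS.
  by have /exists_inP := domS u uS.
by apply/exists_inP/domS.
Qed.

Lemma connect_adjC (G : graph) : connect_sym (@adj G).
Proof. exact/sym_connect_sym/adj_sym. Qed.

Lemma dominating_pair_connected (G : graph) (v w : G) :
  dominating [set v; w] -> connect (@adj G) v w -> connected G.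
Proof.
move=> /dominatingP dom_vw vw.
suff from_v x : connect (@adj G) v x.
  apply/forallP=> x; apply/forallP=> y.
  by apply: connect_trans (from_v y); rewrite connect_adjC.
have [|/dom_vw[z]] := boolP (x \in [set v; w]).
  by rewrite !inE => /pred2P[] ->.
rewrite adj_sym => z_vw /connect1; apply: connect_trans.
by move: z_vw; rewrite !inE => /pred2P[] ->.
Qed.

Lemma dominating_pair_cover (G : graph) (v w x : G) :
  dominating [set v; w] -> connect (@adj G) v x || connect (@adj G) w x.
Proof.
move=> /dominatingP dom_vw.
have [|/dom_vw[z]] := boolP (x \in [set v; w]).
  by rewrite !inE => /pred2P[] ->; rewrite connect0 ?orbT.
by rewrite !inE adj_sym => /pred2P[] -> /connect1 ->; rewrite ?orbT.
Qed.

(** No vertex of the component of [v] is adjacent to [w], so [v] is the only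
    member of the pair that can move to [x]; afterwards [x] is the
    only vertex left to dominate [y]. *)
Lemma secure_dominating_pair_clique (G : graph) (v w x y : G) :
    secure_dominating [set v; w] -> ~~ connect (@adj G) v w ->
    connect (@adj G) v x -> connect (@adj G) v y -> x != y ->
  adj x y.
Proof.
case/andP=> /dominatingP dom_vw /forall_inP sec_vw vNw.
have neq_w z : connect (@adj G) v z -> z != w by apply: contraTneq => ->.
have adj_wF z : connect (@adj G) v z -> adj z w = false.
  move=> vz; apply: contraNF vNw => /connect1; exact: connect_trans.
have adj_v z : connect (@adj G) v z -> z != v -> adj z v.
  move=> vz zNv; have [|t] := dom_vw z; first by rewrite !inE negb_or zNv neq_w.
  by rewrite !inE => /pred2P[] -> //; rewrite adj_wF.
move=> vx vy neq_xy.
have [eq_xv | xNv] := eqVneq x v.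
  by rewrite eq_xv adj_sym adj_v // -eq_xv eq_sym.
have /sec_vw/exists_inP[t] : x \notin [set v; w].
  by rewrite !inE negb_or xNv neq_w.
rewrite !inE => /pred2P[] ->; last by rewrite adj_wF.
case/andP=> _ /dominatingP/(_ y)[|z].
  by rewrite !inE eq_sym (negPf neq_xy) (negPf (neq_w _ vy)) orbF andNb.
rewrite !inE => /predU1P[-> | ]; first by rewrite adj_sym.
by case/andP=> /negPf-> /= /eqP->; rewrite adj_wF.
Qed.

(** * Disjoint unions of two cliques *)

Definition two_cliques (G : graph) (a : pred G) : Prop :=
  forall x y : G, adj x y = (x != y) && (a x == a y).

Lemma secure_dominating_pair_two_cliques (G : graph) (v w : G) :
    secure_dominating [set v; w] -> ~~ connected G ->
  two_cliques (connect (@adj G) v) /\ ~~ connect (@adj G) v w.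
Proof.
move=> sec_vw disG; have dom_vw : dominating [set v; w] by case/andP: sec_vw.
have vNw : ~~ connect (@adj G) v w.
  by apply: contra disG; apply: dominating_pair_connected.
split=> // x y; apply/idP/andP=> [xy | [neq_xy /eqP eq_a]].
  split; first by apply: contraTneq xy => ->; rewrite adj_irrefl.
  by apply/eqP/same_connect_r; [apply: connect_adjC | apply: connect1].
have [vx | vNx] := boolP (connect (@adj G) v x).
  have vy : connect (@adj G) v y by rewrite -eq_a.
  exact: (secure_dominating_pair_clique sec_vw).
have w_conn z : ~~ connect (@adj G) v z -> connect (@adj G) w z.
  by have := dominating_pair_cover z dom_vw; case: connect.
apply: (@secure_dominating_pair_clique G w v) => //; rewrite 1?setUC //.
- by rewrite connect_adjC.
- exact: w_conn.
- by apply: w_conn; rewrite -eq_a.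
Qed.

Lemma two_cliques_dominating (G : graph) (a : pred G) (S : {set G}) :
    two_cliques a -> (forall b, exists2 v, v \in S & a v = b) ->
  dominating S.
Proof.
move=> adjE meetS; apply/dominatingP=> u uS.
have [v vS av] := meetS (a u); exists v => //.
by rewrite adjE av eqxx andbT; apply: contraNneq uS => ->.
Qed.

Lemma two_cliques_dominating_pair (G : graph) (a : pred G) (v w : G) :
  two_cliques a -> a v != a w -> dominating [set v; w].
Proof.
move=> adjE neq_a; apply: two_cliques_dominating adjE _ => b.
have [<- | Nb] := eqVneq (a v) b; first by exists v; rewrite ?set21.
by exists w; rewrite ?set22 //; case: (a v) (a w) b neq_a Nb => [] [] [].
Qed.

(** The defender is the member of the pair on the attacked side. *)
Lemma two_cliques_secure_pair (G : graph) (a : pred G) (v w : G) :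
  two_cliques a -> a v != a w -> secure_dominating [set v; w].
Proof.
move=> adjE neq_a; have defend (x y u : G) : a x != a y -> u \notin [set x; y] ->
    a u = a x -> exists2 t, t \in [set x; y]
      & adj u t && dominating (u |: ([set x; y] :\ t)).
  move=> neq_xy u_xy eq_a; exists x; first exact: set21.
  have yNx : y != x by apply: contraNneq neq_xy => ->.
  have -> : [set x; y] :\ x = [set y].
    by apply/setP=> t; rewrite !inE; case: eqVneq => [->|] //=; rewrite eq_sym (negPf yNx).
  move: u_xy; rewrite adjE eq_a eqxx andbT !inE negb_or => /andP[-> _] /=.
  by apply: two_cliques_dominating_pair adjE _; rewrite eq_a.
rewrite /secure_dominating (two_cliques_dominating_pair adjE) //=.
apply/forall_inP=> u u_vw; apply/exists_inP.
have [eq_a | Neq_a] := eqVneq (a u) (a v); first exact: defend.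
rewrite setUC in u_vw *; apply: defend => //; first by rewrite eq_sym.
by case: (a u) (a v) (a w) neq_a Neq_a => [] [] [].
Qed.

Lemma two_cliques_dominating1F (G : graph) (a : pred G) (v w : G) :
  two_cliques a -> a v != a w -> dominating [set v] = false.
Proof.
move=> adjE neq_a; apply/negP=> /dominatingP/(_ w)[|t].
  by rewrite inE; apply: contraNneq neq_a => ->.
by rewrite inE => /eqP->; rewrite adjE eq_sym [a w == _]eq_sym (negPf neq_a) andbF.
Qed.

Lemma two_cliques_sec_partition (G : graph) (a : pred G) :
    two_cliques a -> (forall b, exists v, a v = b) ->
  sec_partition (singletons G).
Proof.
move=> adjE surj_a; rewrite /sec_partition singletons_partition.
apply/forall_inP=> _ /imsetP[v _ ->]; apply/orP; right.
have [w aw] := surj_a (~~ a v).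
have neq_a : a v != a w by rewrite aw; case: (a v).
have Nsec (x y : G) : a x != a y -> ~~ secure_dominating [set x].
  by move=> axy; rewrite /secure_dominating (two_cliques_dominating1F adjE axy).
have neq_vw : v != w by apply: contraNneq neq_a => ->.
rewrite (Nsec v w) //=; apply/exists_inP; exists [set w]; first exact: imset_f.
rewrite (inj_eq set1_inj) eq_sym neq_vw /=.
apply/and4P; split.
- by rewrite disjoints1 inE.
- exact: Nsec neq_a.
- by apply: (Nsec _ v); rewrite eq_sym.
- exact: two_cliques_secure_pair adjE neq_a.
Qed.

Lemma two_cliques_SEC (G : graph) (a : pred G) :
  two_cliques a -> (forall b, exists v, a v = b) -> SEC G = #|G|.
Proof.
move=> adjE surj_a; apply/eqP; rewrite eqn_leq SEC_leq /=.
rewrite -card_singletons.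
exact: (@leq_bigmax_cond _ (@sec_partition G) (fun P : {set {set G}} => #|P|))
  (two_cliques_sec_partition adjE surj_a).
Qed.

(** One block and its partner already suffice. *)
Lemma SEC_two_cliques (G : graph) :
    0 < #|G| -> ~~ connected G -> SEC G = #|G| ->
  exists2 a : pred G, two_cliques a & forall b, exists v, a v = b.
Proof.
move=> G_gt0 disG eqSEC; have [|P] := SEC_attained (G := G); first by rewrite eqSEC.
case/andP=> partP /forall_inP secP; rewrite {}eqSEC => cardP.
have /forall_inP block1 : [forall A in P, #|A| == 1].
  by rewrite -(card_partition_leqif partP) cardP cardsT.
have /card_gt0P[V PV] : 0 < #|P| by rewrite cardP.
have /cards1P[v eqV] := block1 V PV.
have := secP V PV; rewrite {V PV}eqV => /orP[/andP[/andP[dom_v _] _] | ].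
  case/negP: disG; apply: (@dominating_pair_connected G v v) => //.
  by rewrite setUid.
case/andP=> _ /exists_inP[W PW /andP[_ /and4P[_ _ _]]].
have /cards1P[w ->] := block1 W PW.
case/secure_dominating_pair_two_cliques=> // adjE vNw.
exists (connect (@adj G) v) => // -[]; first by exists v; rewrite connect0.
by exists w; apply: negPf.
Qed.

Lemma disjoint_union_complete_adjE (p q : nat)
    (x y : disjoint_union (complete_graph p) (complete_graph q)) :
  adj x y = (x != y) && (is_inl x == is_inl y).
Proof. by case: x y => [i|i] [j|j]; rewrite ?andbT ?andbF. Qed.

(** The isomorphism numbers each clique by the enumeration of its vertices. *)
Lemma isomorphic_two_cliquesP (G : graph) :
  (exists p q : nat, [/\ 0 < p, 0 < q, p + q = #|G| &
     isomorphic G (disjoint_union (complete_graph p) (complete_graph q))]) <->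
  (exists2 a : pred G, two_cliques a & forall b, exists v, a v = b).
Proof.
split=> [[p [q [p_gt0 q_gt0 _ [f [[g fK gK] adj_f]]]]] | [a adjE surj_a]].
  exists (fun x => is_inl (f x)) => [x y|b].
    by rewrite -adj_f disjoint_union_complete_adjE (can_eq fK).
  by case: b; [exists (g (inl (Ordinal p_gt0))) | exists (g (inr (Ordinal q_gt0)))];
    rewrite gK.
have [[v av] [w aw]] := (surj_a true, surj_a false).
have av' : v \in a by [].
have aw' : w \in predC a by rewrite inE /= aw.
exists #|a|, #|predC a|; split; last 1 first.
- pose f x : 'I_#|a| + 'I_#|predC a| :=
    if a x then inl (enum_rank_in av' x) else inr (enum_rank_in aw' x).
  pose g (s : 'I_#|a| + 'I_#|predC a|) : G :=
    match s with inl i => enum_val i | inr i => enum_val i end.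
  have fK : cancel f g.
    move=> x; rewrite /f; case: ifPn => ax /=; exact: enum_rankK_in.
  have gK : cancel g f.
    rewrite /f; case=> i /=.
      by have -> : a (enum_val i) := enum_valP i; rewrite enum_valK_in.
    by have /negPf-> : ~~ a (enum_val i) := enum_valP i; rewrite enum_valK_in.
  exists f; split; first by exists g.
  move=> x y; rewrite disjoint_union_complete_adjE (can_eq fK) adjE; congr (_ && _).
  by rewrite /f; do 2 case: ifP => _.
- by apply/card_gt0P; exists v.
- by apply/card_gt0P; exists w.
- exact: cardC.
Qed.

Theorem theorem3p2 (G : graph) (n : nat) (G_nonempty : 0 < #|G|)
    (G_order : #|G| = n) (G_disconnected : ~~ connected G) :
  SEC G = n <->
  exists p q : nat, [/\ 0 < p, 0 < q, p + q = n &
    isomorphic G (disjoint_union (complete_graph p) (complete_graph q))].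
Proof.
rewrite -G_order; split=> [eqSEC | /isomorphic_two_cliquesP[a adjE surj_a]].
  exact/isomorphic_two_cliquesP/SEC_two_cliques.
exact: two_cliques_SEC adjE surj_a.
Qed.
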